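(* Let $(M,F)$ be a closed foliated manifold, let $g^{TM}$ be a Riemannian metric on $TM$ with restriction $g^F$ to $F$, and let $F^\bot$ be the $g^{TM}$-orthogonal complement of $F$. For $\varepsilon>0$ let $\nabla^{F^\bot,\varepsilon}$ be the connection on $F^\bot$ obtained by compressing to $F^\bot$ the Levi-Civita connection of $g^{TM,\varepsilon}=g^F\oplus\frac1\varepsilon g^{F^\bot}$. Then along each leaf $L$ of $F$ the following identity holds: $$\lim_{\varepsilon\to 0}\left.\nabla^{F^\bot,\varepsilon}\right|_L=\widetilde\nabla^L,$$ where $\widetilde\nabla^L=\dot\nabla^L+\frac12\omega^L$ is the unitary connection on $F^\bot|_L$ associated to the Bott connection $\dot\nabla^L$.
   Context: $M$ is a closed smooth manifold and $F\subset TM$ is an integrable subbundle. $g^{F^\bot}$ is the restriction of $g^{TM}$ to $F^\bot$, so $TM=F\oplus F^\bot$ and $g^{TM}=g^F\oplus g^{F^\bot}$ (orthogonal splittings); $TM/F$ is identified with $F^\bot$. Let $p^\bot:TM\to F^\bot$ be the orthogonal projection. For $\varepsilon>0$ let $\nabla^{TM,\varepsilon}$ be the Levi-Civita connection of $g^{TM,\varepsilon}=g^F\oplus\frac1\varepsilon g^{F^\bot}$, and set $\nabla^{F^\bot,\varepsilon}=p^\bot\nabla^{TM,\varepsilon}p^\bot$, a connection on $F^\bot$. For a leaf $L$ of $F$, the Bott connection on $F^\bot|_L$ is $$\dot\nabla^L_XU=p^\bot[X,U],\qquad X\in\Gamma(TL),\ U\in\Gamma(F^\bot).$$ Its dual $\dot\nabla^{L*}$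 with respect to $g^{F^\bot}$ is the connection determined by $X\langle U,V\rangle=\langle\dot\nabla^{L*}_XU,V\rangle+\langle U,\dot\nabla^L_XV\rangle$ for $X\in\Gamma(TL)$, $U,V\in\Gamma(F^\bot)$. Put $$\omega^L=(g^{F^\bot})^{-1}\dot\nabla^Lg^{F^\bot}=\dot\nabla^{L*}-\dot\nabla^L,$$ a one-form on $L$ with values in $\mathrm{End}(F^\bot|_L)$, and $\widetilde\nabla^L=\dot\nabla^L+\frac12\omega^L$. *)

(* Defs.v *)
From HB Require Import structures.
From mathcomp Require Import all_boot all_order all_algebra.
From mathcomp Require Import all_classical all_reals all_analysis.
From mathcomp Require Import ring.
Set Implicit Arguments.
Unset Strict Implicit.
Unset Printing Implicit Defensive.
Import Order.TTheory GRing.Theory Num.Theory.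
Import numFieldNormedType.Exports.
Local Open Scope classical_set_scope.
Local Open Scope ring_scope.

Fixpoint Ck (R : realType) (V W : normedModType R) (k : nat) (D : set V)
    (f : V -> W) : Prop :=
  match k with
  | 0 => forall x, D x -> {for x, continuous f}
  | k'.+1 => (forall x, D x -> differentiable f x) /\
             (forall v, Ck k' D (fun x => 'D_v f x))
  end.

Definition smooth_near (R : realType) (V W : normedModType R) (x : V)
    (f : V -> W) : Prop :=
  exists2 D : set V, open_nbhs x D & forall k, Ck k D f.

(* The inverse of a chart is a total function, used only on cmap @` cdom. *)
Record chart (R : realType) (n : nat) (T : topologicalType) := Chart {
  cdom : set T;
  cmap : T -> 'rV[R]_n;
  cinv : 'rV[R]_n -> T;
  open_cdom : open cdom;
  open_cimg : open (cmap @` cdom);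
  cmapK : {in cdom, cancel cmap cinv};
  cmap_continuous : forall x, cdom x -> {for x, continuous cmap};
  cinv_continuous : forall y, (cmap @` cdom) y -> {for y, continuous cinv} }.

(* Any smooth atlas is allowed, not only a maximal one. *)
Record manifold (R : realType) (n : nat) := Manifold {
  carrier :> topologicalType;
  atlas : set (chart R n carrier);
  manifold_hausdorff : hausdorff_space carrier;
  manifold_second_countable : @second_countable carrier;
  atlas_cover : forall p : carrier, exists2 c, atlas c & cdom c p;
  atlas_smooth : forall c d, atlas c -> atlas d ->
    forall p, cdom c p -> cdom d p ->
    smooth_near (cmap c p) (cmap d \o cinv c) }.

Section Tangent.
Context {R : realType} {n : nat} {M : manifold R n}.
Implicit Types (p : M) (f g : M -> R).

(* f is smooth on some neighbourhood of p *)
Definition smooth_at p f : Prop :=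
  \forall q \near p, forall c, atlas c -> cdom c q ->
    smooth_near (cmap c q) (f \o cinv c).

(* Derivations at p of the algebra of germs at p of smooth functions.  A germ
   is represented by any total function which is smooth near p; the last clause
   fixes the irrelevant values, so that equal derivations are equal
   functions. *)
Definition derivation_at p (v : (M -> R) -> R^o) : Prop :=
  [/\ forall a f g, smooth_at p f -> smooth_at p g ->
        v (fun x => a * f x + g x) = a * v f + v g,
      forall f g, smooth_at p f -> smooth_at p g ->
        v (fun x => f x * g x) = v f * g p + f p * v g,
      forall f g, smooth_at p f -> (\forall q \near p, f q = g q) -> v f = v g
    & forall f, ~ smooth_at p f -> v f = 0].

Definition derivation_pred p : {pred ((M -> R) -> R^o)} :=
  fun v => `[< derivation_at p v >].

Lemma derivation_submod p : submod_closed (derivation_pred p).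
Proof.
split.
  apply/asboolP; split=> //= [a f g _ _|f g _ _]; first by rewrite mulr0 addr0.
  by rewrite mul0r mulr0 addr0.
move=> a u w /asboolP[u1 u2 u3 u4] /asboolP[w1 w2 w3 w4].
apply/asboolP; split.
- by move=> b f g sf sg; rewrite /= !fctE /= u1 // w1 // /GRing.scale /=; ring.
- by move=> f g sf sg; rewrite /= !fctE /= u2 // w2 // /GRing.scale /=; ring.
- by move=> f g sf fg; rewrite /= !fctE /= (u3 _ _ sf fg) (w3 _ _ sf fg).
- by move=> f nf; rewrite /= !fctE /= u4 // w4 // scaler0 addr0.
Qed.

HB.instance Definition _ p :=
  GRing.isSubmodClosed.Build R ((M -> R) -> R^o) (derivation_pred p)
    (derivation_submod p).

Record tangent p := Tangent {
  tangent_val :> (M -> R) -> R^o;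
  tangent_valP : tangent_val \in derivation_pred p }.

HB.instance Definition _ p := [isSub for @tangent_val p].
HB.instance Definition _ p := [Choice of tangent p by <:].
HB.instance Definition _ p := [SubChoice_isSubLmodule of tangent p by <:].

End Tangent.

Section Fields.
Context {R : realType} {m n : nat} {N : manifold R m} {M : manifold R n}.

Definition smooth_map (h : N -> M) : Prop :=
  continuous h /\
  forall q c d, atlas c -> cdom c q -> atlas d -> cdom d (h q) ->
    smooth_near (cmap c q) (cmap d \o h \o cinv c).

(* The default 0 of insubd is not used when h is smooth: see tangent_mapE. *)
Definition tangent_map (h : N -> M) (q : N) (v : tangent q) : tangent (h q) :=
  insubd 0 (fun f => if `[< smooth_at (h q) f >] then v (f \o h) else 0).

(* Sections of the pullback h^*TM; vector fields are the case h = idfun. *)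
Definition field_along (h : N -> M) := forall q : N, tangent (h q).

(* s is a smooth section of h^*E on some neighbourhood of q *)
Definition smooth_section (h : N -> M) (E : forall p : M, set (tangent p))
    (q : N) (s : field_along h) : Prop :=
  \forall x \near q, E (h x) (s x) /\
    forall f : M -> R, smooth_at (h x) f -> smooth_at x (fun y => s y f).

(* Operators (D_v s)(q), for v tangent at q. *)
Definition operator_along (h : N -> M) :=
  forall q : N, tangent q -> field_along h -> tangent (h q).

End Fields.

Definition full {R : realType} {n : nat} {M : manifold R n} (p : M) :
  set (tangent p) := setT.

(* D is a connection on the vector bundle h^*E.  A connection is a local
   operator, and it is given here by its action on germs of sections: D q v s
   is meaningful when s is a smooth section of h^*E near q. *)
Record is_connection {R : realType} {m n : nat} {N : manifold R m}
    {M : manifold R n} (h : N -> M) (E : forall p : M, set (tangent p))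
    (D : operator_along h) : Prop := IsConnection {
  connection_local : forall q v (s t : field_along h),
    smooth_section E q s -> (\forall x \near q, s x = t x) ->
    D q v s = D q v t;
  connection_linear : forall q a (v w : tangent q) (s : field_along h),
    smooth_section E q s -> D q (a *: v + w) s = a *: D q v s + D q w s;
  connection_additive : forall q v (s t : field_along h),
    smooth_section E q s -> smooth_section E q t ->
    D q v (fun x => s x + t x) = D q v s + D q v t;
  connection_leibniz : forall q (v : tangent q) (f : N -> R)
      (s : field_along h),
    smooth_at q f -> smooth_section E q s ->
    D q v (fun x => f x *: s x) = v f *: s q + f q *: D q v s;
  connection_smooth : forall q (X : field_along (@idfun N))
      (s : field_along h),
    smooth_section full q X -> smooth_section E q s ->
    smooth_section E q (fun x => D x (X x) s) }.

Section Geometry.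
Context {R : realType} {n : nat} {M : manifold R n}.
Local Notation vfield := (field_along (@idfun M)).
Implicit Types (F E : forall p : M, set (tangent p)) (X Y Z : vfield).
Implicit Type g : forall p : M, tangent p -> tangent p -> R.

(* The default 0 of insubd is not used when X and Y are smooth near p: see
   bracketE. *)
Definition bracket X Y : vfield := fun p =>
  insubd 0 (fun f => if `[< smooth_at p f >]
                     then X p (fun q => Y q f) - Y p (fun q => X q f) else 0).

(* Near each point TM has a smooth frame whose first k members frame F. *)
Definition subbundle (k : nat) F : Prop :=
  (k <= n)%N /\
  forall p : M, exists X : 'I_n -> vfield,
    (forall i, smooth_section full p (X i)) /\
    \forall q \near p,
      [/\ forall a : 'I_n -> R,
            \sum_i a i *: X i q = 0 -> forall i, a i = 0,
          forall v : tangent q, exists a : 'I_n -> R, v = \sum_i a i *: X i q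
        & F q = [set \sum_i a i *: X i q
                | a in [set a : 'I_n -> R |
                        forall i : 'I_n, (k <= i)%N -> a i = 0]]].

Definition integrable_bundle F : Prop :=
  forall p X Y, smooth_section F p X -> smooth_section F p Y ->
    smooth_section F p (bracket X Y).

Definition riemannian g : Prop :=
  [/\ forall p u v, g p u v = g p v u,
      forall p a u v w, g p (a *: u + v) w = a * g p u w + g p v w,
      forall p v, v != 0 -> 0 < g p v v
    & forall p X Y, smooth_section full p X -> smooth_section full p Y ->
        smooth_at p (fun q => g q (X q) (Y q))].

Definition orthocomp g F (p : M) : set (tangent p) :=
  [set v | forall w, F p w -> g p v w = 0].

(* p^bot, the g-orthogonal projection onto the orthogonal complement of F *)
Definition pbot g F (p : M) (v : tangent p) : tangent p :=
  xget 0 [set w | orthocomp g F w /\ F p (v - w)].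

(* g^{TM,eps} = g^F + eps^-1 g^{F^bot} *)
Definition adiabatic g F (eps : R) (p : M) (u v : tangent p) : R :=
  g p (u - pbot g F u) (v - pbot g F v) +
  eps^-1 * g p (pbot g F u) (pbot g F v).

Definition levi_civita g (D : operator_along (@idfun M)) : Prop :=
  [/\ is_connection full D,
      forall p X Y, smooth_section full p X -> smooth_section full p Y ->
        D p (X p) Y - D p (Y p) X = bracket X Y p
    & forall p (v : tangent p) Y Z,
        smooth_section full p Y -> smooth_section full p Z ->
        v (fun q => g q (Y q) (Z q)) =
        g p (D p v Y) (Z p) + g p (Y p) (D p v Z)].

(* p^bot D p^bot *)
Definition compression g F (D : operator_along (@idfun M)) :
    operator_along (@idfun M) :=
  fun p v U => pbot g F (D p v (fun q => pbot g F (U q))).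

Definition integral_manifold k F (L : manifold R k) (h : L -> M) : Prop :=
  [/\ smooth_map h, injective h, [set: L] !=set0, connected [set: L]
    & forall q : L, injective (@tangent_map R k n L M h q) /\
                    range (@tangent_map R k n L M h q) = F (h q)].

(* A leaf is a maximal connected integral manifold, immersed by h. *)
Definition leaf k F (L : manifold R k) (h : L -> M) : Prop :=
  integral_manifold F h /\
  forall (L' : manifold R k) (h' : L' -> M), integral_manifold F h' ->
    range h' `&` range h !=set0 -> range h' `<=` range h.

Section Along.
Context {k : nat} {L : manifold R k} (h : L -> M).

(* DL is the restriction to L, i.e. the pullback by h, of the connection D
   on E. *)
Definition restriction E (D : operator_along (@idfun M))
    (DL : operator_along h) : Prop :=
  is_connection E DL /\
  forall q (v : tangent q) (U : vfield), smooth_section E (h q) U ->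
    DL q v (fun x => U (h x)) = D (h q) (tangent_map h v) U.

(* A vector v tangent to L at q and the restriction to L of a section U of
   F^bot are given; the bracket is taken with any extension X of v to a section
   of F near h q. *)
Definition bott_connection g F (B : operator_along h) : Prop :=
  is_connection (orthocomp g F) B /\
  forall q (v : tangent q) (X U : vfield),
    smooth_section F (h q) X -> X (h q) = tangent_map h v ->
    smooth_section (orthocomp g F) (h q) U ->
    B q v (fun x => U (h x)) = pbot g F (bracket X U (h q)).

Definition dual_connection g E (B B' : operator_along h) : Prop :=
  is_connection E B' /\
  forall q (v : tangent q) (U V : field_along h),
    smooth_section E q U -> smooth_section E q V ->
    v (fun x => g (h x) (U x) (V x)) =
    g (h q) (B' q v U) (V q) + g (h q) (U q) (B q v V).

Definition omega (B B' : operator_along h) : operator_along h :=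
  fun q v U => B' q v U - B q v U.

Definition unitary_connection (B B' : operator_along h) : operator_along h :=
  fun q v U => B q v U + 2^-1 *: omega B B' v U.

End Along.
End Geometry.

Section CkTheory.
Context {R : realType} {V : normedModType R}.

Lemma near_eq_differentiable (W : normedModType R) (f g : V -> W) (x : V) :
  (\forall y \near x, f y = g y) -> differentiable f x -> differentiable g x.
Proof.
move=> fg df; have gx : f x = g x by apply: (nbhs_singleton fg).
have [dfc dff] := (diff_locallyP _ _).1 df.
have E : g \o shift x = cst (g x) + 'd f x +o_ 0 id.
  apply/eqaddoP => e e0.
  have /eqaddoP/(_ _ e0) H := dff.
  have fg0 : \forall h \near 0, f (h + x) = g (h + x).
    by have := fg; rewrite (near_shift 0) subr0; apply: filterS => h.
  near=> h.
  have : f (h + x) = g (h + x) by near: h.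
  have : `|(f \o shift x - (cst (f x) + 'd f x)) h| <= e * `|id h| by near: h.
  by rewrite /= !fctE /= gx => + E; rewrite E.
apply/diff_locallyP.
have -> : 'd g x = 'd f x :> (V -> W) by apply: diff_unique.
by split.
Unshelve. all: by end_near. Qed.

Lemma CkS (W : normedModType R) k D (f : V -> W) : Ck k.+1 D f -> Ck k D f.
Proof.
elim: k f => [|k IH] f [df dfk]; first by move=> x /df /differentiable_continuous.
by split=> // v; exact/IH/dfk.
Qed.

Lemma Ck_subset (W : normedModType R) k D D' (f : V -> W) :
  D' `<=` D -> Ck k D f -> Ck k D' f.
Proof.
move=> DD; elim: k f => [|k IH] f /=; first by move=> H x /DD /H.
by move=> [H1 H2]; split=> [x /DD /H1//|v]; exact/IH/H2.
Qed.

Lemma Ck_eq (W : normedModType R) k D (f g : V -> W) :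
  open D -> (forall x, D x -> f x = g x) -> Ck k D f -> Ck k D g.
Proof.
move=> oD; elim: k f g => [|k IH] f g fg /=.
  move=> H x Dx; have H' : f @ x --> f x := H x Dx.
  have nE : \forall y \near x, f y = g y.
    have : nbhs x D by exact: open_nbhs_nbhs.
    by apply: filterS; exact: fg.
  change (g @ x --> g x); rewrite -(fg _ Dx).
  by apply: cvg_trans H'; apply: near_eq_cvg; apply: filterS nE.
move=> [df dk]; split=> [x Dx|v].
  apply: near_eq_differentiable (df _ Dx).
  have : nbhs x D by exact: open_nbhs_nbhs.
  by apply: filterS; exact: fg.
apply: IH (dk v) => x Dx; apply: near_eq_derive.
have : nbhs x D by exact: open_nbhs_nbhs.
by apply: filterS; exact: fg.
Qed.

Lemma Ck_cst (W : normedModType R) k D (a : W) : Ck k D (cst a : V -> W).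
Proof.
elim: k a => [a x _|k IH a /=]; first exact: cst_continuous.
split=> [x _|v]; first exact: differentiable_cst.
by rewrite (_ : (fun x => _) = cst 0)//; apply/funext => x; rewrite derive_cst.
Qed.

Lemma CkD (W : normedModType R) k D (f g : V -> W) : open D ->
  Ck k D f -> Ck k D g -> Ck k D (fun x => f x + g x).
Proof.
move=> oD; elim: k f g => [|k IH] f g.
  by move=> cf cg x Dx; apply: continuousD; [exact: cf|exact: cg].
move=> [df fk] [dg gk]; split=> [x Dx|v].
  by apply: differentiableD; [exact: df|exact: dg].
apply: (Ck_eq oD _ (IH _ _ (fk v) (gk v))) => x Dx.
by rewrite -deriveD//; apply: diff_derivable; [exact: df|exact: dg].
Qed.

Lemma CkM k D (f g : V -> R) : open D ->
  Ck k D f -> Ck k D g -> Ck k D (fun x => f x * g x).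
Proof.
move=> oD; elim: k f g => [|k IH] f g.
  by move=> cf cg x Dx; apply: continuousM; [exact: cf|exact: cg].
move=> f1 g1; have [df fk] := f1; have [dg gk] := g1; split=> [x Dx|v].
  by apply: differentiableM; [exact: df|exact: dg].
apply: (Ck_eq oD _ (CkD oD (IH _ _ (CkS f1) (gk v)) (IH _ _ (CkS g1) (fk v)))).
move=> x Dx.
by rewrite -[RHS]/('D_v (f * g) x) deriveM//; apply: diff_derivable; [exact: df|exact: dg].
Qed.

Lemma Ck_sum (W : normedModType R) k D n (f : 'I_n -> V -> W) : open D ->
  (forall i, Ck k D (f i)) -> Ck k D (fun x => \sum_i f i x).
Proof.
move=> oD; elim: n f => [|n IH] f H.
  by apply: Ck_eq (Ck_cst k D 0) => // x _; rewrite big_ord0.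
have := CkD oD (H ord0) (IH (fun i => f (lift ord0 i)) (fun i => H _)).
by apply: Ck_eq => // x _; rewrite big_ord_recl.
Qed.

Lemma Ck_coord m n k D (f : V -> 'M[R]_(m, n)) i j : open D ->
  Ck k D f -> Ck k D (fun x => f x i j : R).
Proof.
move=> oD; elim: k f => [|k IH] f.
  move=> cf x Dx; apply: (@continuous_comp _ _ _ f (fun M : 'M[R]_(m,n) => M i j)); first exact: cf.
  exact: coord_continuous.
move=> [df fk]; split=> [x Dx|v].
  apply: (@differentiable_comp _ _ _ _ f (fun M : 'M[R]_(m,n) => M i j)); first exact: df.
  exact: differentiable_coord.
apply: (Ck_eq oD _ (IH _ (fk v))) => x Dx.
by rewrite derive_mx ?mxE//; exact/diff_derivable/df.
Qed.

End CkTheory.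

Section CkComp.
Context {R : realType} {V : normedModType R}.

Lemma Ck_comp n k D D' (f : V -> 'rV[R]_n) (h : 'rV[R]_n -> R) :
  open D -> open D' -> (forall x, D x -> D' (f x)) ->
  Ck k D f -> Ck k D' h -> Ck k D (h \o f).
Proof.
move=> oD oD' fD; elim: k f h fD => [|k IH] f h fD.
  by move=> cf ch x Dx; apply: continuous_comp; [exact: cf|exact/ch/fD].
move=> f1 h1; have [df fk] := f1; have [dh hk] := h1; split=> [x Dx|v].
  by apply: differentiable_comp; [exact: df|exact/dh/fD].
have key : Ck k D (fun x => \sum_(i < n) ('D_v f x 0 i) * (('D_(delta_mx 0 i) h) \o f) x).
  apply: Ck_sum => // i; apply: CkM => //.
    by apply: (@Ck_coord R V 1 n k D (fun x => 'D_v f x) 0 i) => //; exact: fk.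
  by apply: (IH _ _ fD (CkS f1)); exact: hk.
apply: (Ck_eq oD _ key) => x Dx.
have dfx := df _ Dx; have dhx := dh _ (fD _ Dx).
rewrite [RHS]deriveE; last exact: differentiable_comp.
have E : 'd f x v = \sum_(i < n) 'D_v f x 0 i *: delta_mx 0 i by rewrite -row_sum_delta deriveE.
rewrite diff_comp//= E linear_sum/=.
by apply: eq_bigr => i _; rewrite linearZ/= -deriveE.
Qed.

End CkComp.

Section SmoothAt.
Context {R : realType} {n : nat} {M : manifold R n}.
Implicit Types (p : M) (f g : M -> R).

Lemma smooth_near2 (V : normedModType R) (x : V) (f g e : V -> R) :
  (forall k D, open D -> Ck k D f -> Ck k D g -> Ck k D e) ->
  smooth_near x f -> smooth_near x g -> smooth_near x e.
Proof.
move=> H [D [oD Dx] fD] [D' [oD' Dx'] gD].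
exists (D `&` D'); first by split; [exact: openI|].
move=> k; apply: H; first exact: openI.
  by apply: Ck_subset (fD k) => y [].
by apply: Ck_subset (gD k) => y [].
Qed.

Lemma smooth_atM p f g : smooth_at p f -> smooth_at p g ->
  smooth_at p (fun q => f q * g q).
Proof.
move=> sf sg; near=> q => c ac cq.
have : smooth_near (cmap c q) (f \o cinv c) by move: c ac cq; near: q.
have : smooth_near (cmap c q) (g \o cinv c) by move: c ac cq; near: q.
move=> sg' sf'; apply: smooth_near2 sf' sg' => k D; exact: CkM.
Unshelve. all: by end_near. Qed.

Lemma smooth_at_lin p a f g : smooth_at p f -> smooth_at p g ->
  smooth_at p (fun q => a * f q + g q).
Proof.
move=> sf sg; near=> q => c ac cq.
have : smooth_near (cmap c q) (f \o cinv c) by move: c ac cq; near: q.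
have : smooth_near (cmap c q) (g \o cinv c) by move: c ac cq; near: q.
move=> sg' sf'; apply: smooth_near2 sf' sg' => k D oD fk gk.
apply: (@CkD R _ _ k D (fun x => a * f (cinv c x)) (g \o cinv c)) => //.
by apply: (@CkM R _ k D (cst a)) => //; exact: Ck_cst.
Unshelve. all: by end_near. Qed.

Lemma smooth_at_near p f : smooth_at p f -> \forall q \near p, smooth_at q f.
Proof. by move=> /near_join. Qed.

Lemma smooth_at_eq p f g : (\forall q \near p, f q = g q) ->
  smooth_at p f -> smooth_at p g.
Proof.
move=> /near_join fg sf; near=> q => c ac cq.
have [D oD fD] : smooth_near (cmap c q) (f \o cinv c) by move: c ac cq; near: q.
have fgq : \forall q \near q, f q = g q by near: q.
have ci : (cinv c @ cmap c q --> q).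
  have : cinv c @ cmap c q --> cinv c (cmap c q).
    by apply: cinv_continuous; exists q.
  by rewrite (cmapK _) ?inE.
have fgy : \forall y \near cmap c q, f (cinv c y) = g (cinv c y) by exact: ci fgq.
exists (D `&` [set y | f (cinv c y) = g (cinv c y)]°).
  split; first by apply: openI; [exact: oD.1|exact: open_interior].
  by split; [exact: oD.2|exact: fgy].
move=> k; apply: (@Ck_eq _ _ _ k _ (f \o cinv c)).
- by apply: openI; [exact: oD.1|exact: open_interior].
- by move=> y [_ /interior_subset].
- by apply: Ck_subset (fD k) => y [].
Unshelve. all: by end_near. Qed.

End SmoothAt.

Lemma bracketE {R : realType} {n} {M : manifold R n} (X Y : field_along (@idfun M)) (p : M) f :
  smooth_section full p X -> smooth_section full p Y -> smooth_at p f ->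
  bracket X Y p f = X p (fun q => Y q f) - Y p (fun q => X q f).
Proof.
move=> sX sY sf.
have sX0 f0 : smooth_at p f0 -> smooth_at p (fun y => X y f0).
  by have [_] := nbhs_singleton sX; apply.
have sY0 f0 : smooth_at p f0 -> smooth_at p (fun y => Y y f0).
  by have [_] := nbhs_singleton sY; apply.
have D (Z : field_along (@idfun M)) q : derivation_at q (tangent_val (Z q)).
  by have := tangent_valP (Z q) => /asboolP.
rewrite /bracket -[LHS]/(val _ f) insubdK ?asboolT// unfold_in; apply/asboolP.
have [Xp1 Xp2 Xp3 Xp4] := D X p; have [Yp1 Yp2 Yp3 Yp4] := D Y p.
split.
- move=> a u w su sw.
  rewrite !asboolT//; last exact: smooth_at_lin.
  have E (Z : field_along (@idfun M)) : \forall q \near p, (fun y => Z y (fun x => a * u x + w x)) q = a * Z q u + Z q w.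
    near=> q; have [Z1 _ _ _] := D Z q; apply: Z1.
      by near: q; exact: smooth_at_near.
    by near: q; exact: smooth_at_near.
  rewrite (Xp3 _ _ _ (E Y)); last exact/sY0/smooth_at_lin.
  rewrite (Yp3 _ _ _ (E X)); last exact/sX0/smooth_at_lin.
  rewrite Xp1 ?Yp1//; try by [exact: sX0|exact: sY0].
  by ring.
- move=> u w su sw.
  rewrite !asboolT//; last exact: smooth_atM.
  have E (Z : field_along (@idfun M)) : \forall q \near p, (fun y => Z y (fun x => u x * w x)) q = 1 * (Z q u * w q) + u q * Z q w.
    near=> q; have [_ Z1 _ _] := D Z q; rewrite mul1r; apply: Z1.
      by near: q; exact: smooth_at_near.
    by near: q; exact: smooth_at_near.
  rewrite (Xp3 _ _ _ (E Y)); last exact/sY0/smooth_atM.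
  rewrite (Yp3 _ _ _ (E X)); last exact/sX0/smooth_atM.
  have a1 := sX0 _ su; have a2 := sX0 _ sw; have a3 := sY0 _ su; have a4 := sY0 _ sw.
  rewrite Xp1 ?Yp1//; try exact: smooth_atM.
  by rewrite !Xp2 ?Yp2//; ring.
- move=> u w su uw; have sw : smooth_at p w by exact: smooth_at_eq su.
  rewrite !asboolT//.
  have E (Z : field_along (@idfun M)) : \forall q \near p, (fun y => Z y u) q = Z q w.
    near=> q; have [_ _ Z1 _] := D Z q; apply: Z1.
      by near: q; exact: smooth_at_near.
    by near: q; exact/near_join.
  rewrite (Xp3 _ _ _ (E Y)); last exact: sY0.
  by rewrite (Yp3 _ _ _ (E X)); last exact/sX0.
- by move=> u nu; rewrite asboolF.
Unshelve. all: by end_near. Qed.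

Section Push.
Context {R : realType} {m n : nat} {N : manifold R m} {M : manifold R n}.
Variable (h : N -> M).
Hypothesis sh : smooth_map h.

Lemma smooth_at_comp q (f : M -> R) : smooth_at (h q) f -> smooth_at q (f \o h).
Proof.
have [ch hh] := sh.
move=> sf; have : \forall x \near q, smooth_at (h x) f by exact: (ch q _ (smooth_at_near sf)).
apply: filterS => x /nbhs_singleton sfx c ac cx.
have [d ad dx] := atlas_cover (h x).
have [D [oD Dx] DC] := hh _ _ _ ac cx ad dx.
have [D' [oD' D'x] D'C] := sfx _ ad dx.
have ci : cinv c @ cmap c x --> x.
  have : cinv c @ cmap c x --> cinv c (cmap c x).
    by apply: cinv_continuous; exists x.
  by rewrite (cmapK _) ?inE.
have nd : nbhs (cmap c x) [set y | cdom d (h (cinv c y))].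
  have : nbhs (h x) (cdom d) by apply: open_nbhs_nbhs; split=> //; exact: open_cdom.
  by move=> H; exact: (ci _ (ch x _ H)).
set G := (cmap d \o h \o cinv c).
have cG : {for cmap c x, continuous G} := DC 0%N _ Dx.
have Gx : G (cmap c x) = cmap d (h x) by rewrite /G /= (cmapK _) ?inE.
have nD' : nbhs (cmap c x) [set y | D' (G y)].
  by apply: cG; rewrite Gx; apply: open_nbhs_nbhs; split.
set O := D `&` ([set y | D' (G y)]° `&` [set y | cdom d (h (cinv c y))]°).
have oO : open O by apply: openI => //; apply: openI; exact: open_interior.
exists O; first by split=> //; exact: (conj Dx (conj nD' nd)).
move=> k; apply: (@Ck_eq _ _ _ k _ ((f \o cinv d) \o G)) => //.
  move=> y [_ [_ /interior_subset /= dy]]; rewrite /G /= (cmapK _) ?inE//.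
apply: (@Ck_comp _ _ n k O D') => //.
  by move=> y [_ [/interior_subset]].
by apply: Ck_subset (DC k) => y [].
Qed.

Lemma tangent_mapE q (v : tangent q) (f : M -> R) : smooth_at (h q) f ->
  tangent_map h v f = v (f \o h).
Proof.
move=> sf; rewrite /tangent_map -[LHS]/(val _ f) insubdK ?asboolT//.
have [v1 v2 v3 v4] : derivation_at q (tangent_val v) by have := tangent_valP v => /asboolP.
rewrite unfold_in; apply/asboolP; split.
- move=> a u w su sw; rewrite !asboolT//; last exact: smooth_at_lin.
  by rewrite -v1//; exact: smooth_at_comp.
- move=> u w su sw; rewrite !asboolT//; last exact: smooth_atM.
  by rewrite -(v2 (u \o h) (w \o h))//; exact: smooth_at_comp.
- move=> u w su uw; have sw : smooth_at (h q) w by exact: smooth_at_eq su.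
  rewrite !asboolT//; apply: v3; first exact: smooth_at_comp.
  exact: (sh.1 q _ uw).
- by move=> u nu; rewrite asboolF.
Qed.
End Push.

(* Main.v *)
From HB Require Import structures.
Require Import Defs.
From mathcomp Require Import all_boot all_order all_algebra.
From mathcomp Require Import all_classical all_reals all_analysis.
From mathcomp Require Import ring lra.
Import Order.TTheory GRing.Theory Num.Theory.
Import numFieldNormedType.Exports.
Set Implicit Arguments.
Unset Strict Implicit.
Unset Printing Implicit Defensive.
Local Open Scope classical_set_scope.
Local Open Scope ring_scope.

(** The limit exists because the error is exactly linear in [eps].  Write
    [d_eps] for the difference between the compressed connection along the leaf
    and the unitary connection.  Let [X] be a section of [F], and [W], [V]
    sections of [F^bot].  In Koszul's formula for [g^F + eps^-1 g^{F^bot}] every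
    term which pairs two sections of [F^bot] carries the factor [eps^-1], the
    terms [W<X,V>] and [V<X,W>] vanish, and [<[W,V],X>] carries no factor.  After
    multiplication by [eps],
      [2 <nabla^eps_X W, V> = X<W,V> + <[X,W],V> - <[X,V],W> - eps <[W,V],X>]
    ([koszul_ortho]).  The first three terms on the right add up to
    [2 <(B + 1/2 omega)_X W, V>] by the definitions of the Bott connection [B]
    and of its dual.  So [<d_eps W, V> = - eps/2 <[W,V],X>]
    ([adiabatic_differenceE]), whence [d_eps = eps d_1]
    ([adiabatic_difference_scale]), and the norm of [d_eps] is [eps] times a
    constant.

    Three points are needed to pass from vector fields on [M] to an arbitrary
    section [U] of [F^bot] along the leaf.  First, [U] is near each point a
    combination, with smooth coefficients on the leaf, of restrictions of
    sections of [F^bot] defined on [M] ([normal_section_generators]): the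
    projections to [F^bot] of the coordinate fields generate, and the
    coefficients are the values of [U] on the coordinate functions.  Since
    [d_eps] is a combination of connections whose coefficients add up to 0, it
    is linear over smooth functions, so these restrictions suffice.  Secondly,
    [F^bot] must have enough smooth sections, that is, the orthogonal projection
    of a smooth field must be smooth ([pbot_smooth]); this is the Gram-Schmidt
    process.  Thirdly, [<d_eps W, V>] determines [d_eps W] only if [d_eps W] lies
    in [F^bot].  For the dual connection this follows from the smoothness axiom
    of a connection, once every tangent vector of the leaf extends to a smooth
    field ([leaf_extension]).

    Tangent vectors are derivations of germs, and both the first and the third
    point use that coordinate fields span them.  This is a dimension count: the
    frames which are part of the notion of subbundle bound the dimension of the
    space of derivations, and as many coordinate fields are linearly
    independent ([injective_span], [coord_field_span]). *)

(** * Linear algebra *)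

(** Dimension count: the matrix of the images [phi (e i)] in terms of the [Y j] is
    square, and its rows are independent since [phi] is injective, so it is
    invertible. *)
Lemma injective_span (K : fieldType) (V W : lmodType K) (k : nat)
    (phi : V -> W) (e : 'I_k -> V) (Y : 'I_k -> W) :
  linear phi -> injective phi ->
  (forall a : 'I_k -> K, \sum_i a i *: e i = 0 -> forall i, a i = 0) ->
  (forall v, exists b : 'I_k -> K, phi v = \sum_j b j *: Y j) ->
  forall v, exists a : 'I_k -> K, v = \sum_i a i *: e i.
Proof.
move=> lphi iphi free_e spanY v.
pose f : {linear V -> W} := HB.pack phi (GRing.isLinear.Build K V W *:%R phi lphi).
have fE u : f u = phi u by [].
have [A AE] := choice (fun i => spanY (e i)).
pose A' := \matrix_(i, j) A i j.
have phi_comb (a : 'rV_k) :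
    phi (\sum_i a 0 i *: e i) = \sum_j (a *m A') 0 j *: Y j.
  rewrite -fE linear_sum /= (eq_bigr (fun i => \sum_j (a 0 i * A i j) *: Y j)).
    rewrite exchange_big /=; apply: eq_bigr => j _.
    by rewrite mxE scaler_suml; apply: eq_bigr => i _; rewrite !mxE.
  move=> i _; rewrite -fE linearZ /= AE scaler_sumr.
  by apply: eq_bigr => j _; rewrite scalerA.
have uA : A' \in unitmx.
  rewrite -row_free_unit; apply/row_freeP.
  have : row_free A'.
    rewrite -kermx_eq0; apply/eqP/row_matrixP => i.
    have k0 : row i (kermx A') *m A' = 0 by rewrite -row_mul mulmx_ker row0.
    have := phi_comb (row i (kermx A')); rewrite k0.
    under [RHS]eq_bigr do rewrite mxE scale0r.
    rewrite [RHS]big1 // => phi0; have := iphi _ 0 (etrans phi0 (esym (linear0 f))).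
    by move=> /free_e r0; apply/rowP => j; rewrite r0 row0 mxE.
  by move=> /row_freeP.
have [b bE] := spanY v.
pose b' := \row_j b j.
exists (fun i => (b' *m invmx A') 0 i); apply: iphi.
by rewrite phi_comb -mulmxA mulVmx // mulmx1 bE; apply: eq_bigr => j _; rewrite mxE.
Qed.

(** The Leibniz terms [a] cancel in [x - (y + c (z - y))] because its
    coefficients [1], [-(1 - c)] and [-c] add up to 0. *)
Lemma unitary_leibniz (K : fieldType) (T : lmodType K) (c b : K) (a x y z : T) :
  a + b *: x - (a + b *: y + c *: (a + b *: z - (a + b *: y))) =
  b *: (x - (y + c *: (z - y))).
Proof.
have cancel u w : a + u - (a + w) = u - w by rewrite opprD addrACA subrr add0r.
rewrite cancel -(addrA a (b *: y)) cancel -scalerBr scalerA [c * b]mulrC.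
by rewrite -scalerA -scalerDr -scalerBr.
Qed.

(** * Smooth functions and coordinate fields *)

Section Smooth.
Context {R : realType}.

Lemma CkV (V : normedModType R) k (D : set V) (f : V -> R) : open D ->
  (forall x, D x -> f x != 0) -> Ck k D f -> Ck k D (fun x => (f x)^-1).
Proof.
move=> oD f0; elim: k => [cf x Dx|k IH f1].
  exact: continuousV (f0 _ Dx) (cf _ Dx).
have [df dfk] := f1; split=> [x Dx|v].
  exact: differentiableV (df _ Dx) (f0 _ Dx).
have If := IH (CkS f1).
have key : Ck k D (fun x => (-1 * ((f x)^-1 * (f x)^-1)) * 'D_v f x).
  apply: (CkM oD _ (dfk v)).
  by apply: (CkM (f := cst (-1)) oD _ (CkM oD If If)); exact: Ck_cst.
apply: (Ck_eq oD _ key) => x Dx.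
rewrite -[RHS]/('D_v (fun y => (f y)^-1) x) deriveV; last 2 first.
- exact: f0.
- exact/diff_derivable/df.
by rewrite /GRing.scale /= mulN1r -invfM -expr2.
Qed.

Context {n : nat} {M : manifold R n}.
Implicit Types (p : M) (f : M -> R) (c d : chart R n M).

(** This transports statements near a point of [M] to statements near its image in
    a chart. *)
Lemma cinv_cvg c p : cdom c p -> cinv c @ cmap c p --> p.
Proof.
move=> cp; have : cinv c @ cmap c p --> cinv c (cmap c p).
  by apply: cinv_continuous; exists p.
by rewrite (cmapK _) ?inE.
Qed.

Lemma near_cdom c p : cdom c p -> \forall q \near p, cdom c q.
Proof. by move=> cp; apply: open_nbhs_nbhs; split=> //; exact: open_cdom. Qed.

Lemma smooth_at_cst p (a : R) : smooth_at p (cst a).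
Proof.
by near=> q => c ac cq; exists setT; [exact: open_nbhsT|move=> k; exact: Ck_cst].
Unshelve. all: by end_near. Qed.

Lemma smooth_atV p f : (\forall q \near p, f q != 0) -> smooth_at p f ->
  smooth_at p (fun q => (f q)^-1).
Proof.
move=> /near_join f0 sf; near=> q => c ac cq.
have [D [oD Dq] fD] : smooth_near (cmap c q) (f \o cinv c).
  by move: c ac cq; near: q.
have fq : \forall y \near q, f y != 0 by near: q.
exists (D `&` [set y | f (cinv c y) != 0]°).
  split; first by apply: openI => //; exact: open_interior.
  by split=> //; exact: (cinv_cvg cq fq).
move=> k; apply: CkV.
- by apply: openI => //; exact: open_interior.
- by move=> y [_ /interior_subset].
- by apply: Ck_subset (fD k) => y [].
Unshelve. all: by end_near. Qed.

Lemma smooth_at_coord c p (i : 'I_n) : atlas c -> cdom c p ->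
  smooth_at p (fun q => cmap c q 0 i).
Proof.
move=> ac cp; near=> q => d ad dq.
have cq : cdom c q by near: q; exact: near_cdom.
have [D [oD Dq] cD] := atlas_smooth ad ac dq cq.
exists D => // k.
exact: (@Ck_coord R _ 1 n k D (cmap c \o cinv d) 0 i oD (cD k)).
Unshelve. all: by end_near. Qed.

(** The partial derivative [d/dx_i] at [q] in the chart [c], with the value 0 on
    functions which are not smooth, as tangent vectors require. *)
Definition coord_derivative c (i : 'I_n) (q : M) (f : M -> R) : R^o :=
  if `[< smooth_at q f >] then 'D_(delta_mx 0 i) (f \o cinv c) (cmap c q) else 0.

Lemma coord_derivativeE c i q f : smooth_at q f ->
  coord_derivative c i q f = 'D_(delta_mx 0 i) (f \o cinv c) (cmap c q).
Proof. by rewrite /coord_derivative => sf; rewrite asboolT. Qed.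

Lemma smooth_at_differentiable c q f : atlas c -> cdom c q -> smooth_at q f ->
  differentiable (f \o cinv c) (cmap c q).
Proof.
move=> ac cq /nbhs_singleton /(_ _ ac cq)[D [_ Dq] fD].
by have [+ _] := fD 1%N; apply.
Qed.

Lemma coord_derivation c i q : atlas c -> cdom c q ->
  derivation_at q (coord_derivative c i q).
Proof.
move=> ac cq.
have cK : cinv c (cmap c q) = q by rewrite (cmapK _) ?inE.
have dq f : smooth_at q f ->
    derivable (f \o cinv c) (cmap c q) (delta_mx 0 i).
  by move=> sf; exact/diff_derivable/smooth_at_differentiable.
split=> [a f e sf se|f e sf se|f e sf fe|f nf].
- rewrite !coord_derivativeE //; last exact: smooth_at_lin.
  rewrite (_ : _ \o _ = a *: (f \o cinv c) + (e \o cinv c)) //.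
  by rewrite deriveD ?deriveZ //; [exact: dq|apply: derivableZ; exact: dq|exact: dq].
- rewrite !coord_derivativeE //; last exact: smooth_atM.
  rewrite (_ : _ \o _ = (f \o cinv c) * (e \o cinv c)) //.
  rewrite deriveM; [|exact: dq|exact: dq].
  by rewrite /= cK /GRing.scale /= addrC mulrC.
- rewrite !coord_derivativeE //; last exact: smooth_at_eq sf.
  by apply: near_eq_derive; exact: (cinv_cvg cq fe).
- by rewrite /coord_derivative asboolF.
Qed.

(** Outside the domain of [c] this is the zero vector, a junk value. *)
Definition coord_field c (i : 'I_n) : field_along (@idfun M) :=
  fun q => insubd 0 (coord_derivative c i q).

Lemma coord_fieldE c i q f : atlas c -> cdom c q ->
  coord_field c i q f = coord_derivative c i q f.
Proof.
move=> ac cq; rewrite -[LHS]/(val _ f) insubdK // unfold_in.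
by apply/asboolP; exact: coord_derivation.
Qed.

Lemma coord_field_coord c i j q : atlas c -> cdom c q ->
  coord_field c i q (fun x => cmap c x 0 j) = (i == j)%:R.
Proof.
move=> ac cq; rewrite coord_fieldE // coord_derivativeE; last exact: smooth_at_coord.
have nE : \forall y \near cmap c q, 
    ((fun x : M => cmap c x 0 j) \o cinv c) y = y 0 j.
  have : nbhs (cmap c q) (cmap c @` cdom c).
    by apply: open_nbhs_nbhs; split; [exact: open_cimg|exists q].
  by apply: filterS => _ [x cx <-] /=; rewrite (cmapK _) ?inE.
rewrite (near_eq_derive _ nE).
have dm : derivable (id : 'rV[R]_n -> 'rV[R]_n) (cmap c q) (delta_mx 0 i).
  exact: derivable_id.
have := derive_mx dm => /matrixP /(_ 0 j); rewrite !mxE => <-.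
by rewrite derive_id !mxE eqxx /= eq_sym.
Qed.

(** In another chart the coefficient is a partial derivative composed with a change
    of charts. *)
Lemma coord_field_smooth c i p : atlas c -> cdom c p ->
  smooth_section full p (coord_field c i).
Proof.
move=> ac cp; near=> q.
have cq : cdom c q by near: q; exact: near_cdom.
split=> // f sf.
have fE : \forall y \near q,
    'D_(delta_mx 0 i) (f \o cinv c) (cmap c y) = coord_field c i y f.
  near=> y; rewrite coord_fieldE // ?coord_derivativeE //.
    by near: y; exact: smooth_at_near.
  by near: y; exact: near_cdom.
apply: smooth_at_eq fE _.
near=> x => d ad dx.
have cx : cdom c x by near: x; exact: near_cdom.
have sfx : smooth_at x f by near: x; exact: smooth_at_near.
have [D' [oD' D'x] fD'] := nbhs_singleton sfx c ac cx.
have [D [oD Dx] tD] := atlas_smooth ad ac dx cx.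
set G := cmap c \o cinv d.
have cG : {for cmap d x, continuous G} := tD 0%N _ Dx.
have Gx : G (cmap d x) = cmap c x by rewrite /G /= (cmapK _) ?inE.
have nD' : nbhs (cmap d x) [set y | D' (G y)].
  by apply: cG; rewrite Gx; apply: open_nbhs_nbhs.
set O := D `&` [set y | D' (G y)]°.
have oO : open O by apply: openI => //; exact: open_interior.
exists O => // m.
apply: (@Ck_comp _ _ n m O D' G (fun y => 'D_(delta_mx 0 i) (f \o cinv c) y)) => //.
- by move=> y [_ /interior_subset].
- by apply: Ck_subset (tD m) => y [].
- by have [_] := fD' m.+1; apply.
Unshelve. all: by end_near. Qed.
End Smooth.

(** * Tangent vectors *)

Section TangentVectors.
Context {R : realType} {n : nat} {M : manifold R n}.
Implicit Types (p : M) (f : M -> R).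

Lemma tangent_derivation p (u : tangent p) : derivation_at p (tangent_val u).
Proof. by have := tangent_valP u => /asboolP. Qed.

(** The values on functions which are not smooth are normalized to 0, so they need not
    be compared. *)
Lemma tangent_ext p (u w : tangent p) :
  (forall f, smooth_at p f -> u f = w f) -> u = w.
Proof.
move=> uw; apply: val_inj; apply/funext => f /=.
have [_ _ _ u0] := tangent_derivation u; have [_ _ _ w0] := tangent_derivation w.
by have [/uw//|nf] := pselect (smooth_at p f); rewrite u0 // w0.
Qed.

Lemma tangent_near_eq p (u : tangent p) f e : smooth_at p f ->
  (\forall q \near p, f q = e q) -> u f = u e.
Proof. by have [_ _ + _] := tangent_derivation u; apply. Qed.

Lemma tangent_cst0 p (u : tangent p) : u (cst 0) = 0.
Proof.
have [u1 _ _ _] := tangent_derivation u.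
have s0 : smooth_at p (cst 0 : M -> R) by exact: smooth_at_cst.
have := u1 (-1) _ _ s0 s0; rewrite mulN1r addNr; apply: etrans.
by congr (tangent_val u); apply/funext => x; rewrite /= mulr0 addr0.
Qed.

Lemma tangentZ p (u : tangent p) a (f : M -> R) : smooth_at p f ->
  u (fun q => a * f q) = a * u f.
Proof.
move=> sf; have [u1 _ _ _] := tangent_derivation u.
have := u1 a _ _ sf (smooth_at_cst p 0); rewrite tangent_cst0 addr0.
by apply: etrans; congr (tangent_val u _); apply/funext => x; rewrite /= addr0.
Qed.

Lemma tangent_sumE p (I : finType) (a : I -> R) (u : I -> tangent p) f :
  (\sum_i a i *: u i) f = \sum_i a i * u i f.
Proof.
by rewrite -[LHS]/(val _ f) linear_sum fct_sumE; apply: eq_bigr => i _; rewrite linearZ.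
Qed.

(** The coordinate fields are independent because they are dual to the coordinate
    functions, and the existence of [phi] and [Y] bounds the dimension of the space of
    tangent vectors.  On [M], [phi] is the identity and [Y] a frame; on the leaf, [phi]
    is the differential of the immersion and [Y] a frame of [F]. *)
Lemma coord_field_span (W : lmodType R) (c : chart R n M) (q : M)
    (phi : tangent q -> W) (Y : 'I_n -> W) :
  atlas c -> cdom c q -> linear phi -> injective phi ->
  (forall u, exists b : 'I_n -> R, phi u = \sum_j b j *: Y j) ->
  forall u : tangent q, u = \sum_i u (fun x => cmap c x 0 i) *: coord_field c i q.
Proof.
move=> ac cq lphi iphi spanY u.
have coordE (a : 'I_n -> R) j :
    (\sum_i a i *: (coord_field c i q : tangent q)) (fun x => cmap c x 0 j) = a j.
  rewrite tangent_sumE (bigD1 j) //= coord_field_coord // eqxx mulr1.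
  rewrite big1 ?addr0 // => i ij.
  by rewrite coord_field_coord // (negbTE ij) mulr0.
have [|a ->] := injective_span (e := fun i => coord_field c i q) lphi iphi _ spanY u.
  by move=> a a0 i; rewrite -[a i]coordE a0.
by apply: eq_bigr => i _; rewrite coordE.
Qed.

End TangentVectors.

(** * Smooth sections and connections *)

Section Sections.
Context {R : realType} {m n : nat} {N : manifold R m} {M : manifold R n}.
Variables (h : N -> M) (E : forall p : M, set (tangent p)).
Implicit Types (s t : field_along h) (q : N).

Definition fiberwise_subspace := forall p : M, E (0 : tangent p) /\
  forall a (u w : tangent p), E u -> E w -> E (a *: u + w).

Lemma smooth_section_near q s : smooth_section E q s ->
  \forall x \near q, smooth_section E x s.
Proof. by move=> /near_join. Qed.

Lemma smooth_section_val q s : smooth_section E q s -> E (s q).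
Proof. by move=> /nbhs_singleton[]. Qed.

Lemma smooth_section_apply q s f : smooth_section E q s ->
  smooth_at (h q) f -> smooth_at q (fun y => s y f).
Proof. by move=> /nbhs_singleton[_]; apply. Qed.

Lemma smooth_section_full q s : smooth_section E q s -> smooth_section full q s.
Proof. by apply: filterS => x []. Qed.

Lemma smooth_section_eq q s t : (\forall x \near q, s x = t x) ->
  smooth_section E q s -> smooth_section E q t.
Proof.
move=> /near_join st ss; near=> x.
have stx : \forall y \near x, s y = t y by near: x.
have [Es sf] : E (s x) /\ forall f, smooth_at (h x) f -> smooth_at x (fun y => s y f).
  by near: x.
split=> [|f sfx]; first by rewrite -(nbhs_singleton stx).
by apply: smooth_at_eq (sf f sfx); apply: filterS stx => y ->.
Unshelve. all: by end_near. Qed.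

Hypothesis subE : fiberwise_subspace.

Lemma smooth_section_lin q (a : N -> R) s t : smooth_at q a ->
  smooth_section E q s -> smooth_section E q t ->
  smooth_section E q (fun x => a x *: s x + t x).
Proof.
move=> sa ss st; near=> x; split.
  apply: (subE _).2; apply: smooth_section_val.
    by near: x; exact: smooth_section_near.
  by near: x; exact: smooth_section_near.
move=> f sf; rewrite (_ : (fun y => _) = (fun y => 1 * (a y * s y f) + t y f)); last first.
  by apply/funext => y; rewrite mul1r.
apply: smooth_at_lin; last first.
  by apply: smooth_section_apply => //; near: x; exact: smooth_section_near.
apply: smooth_atM; first by near: x; exact: smooth_at_near.
by apply: smooth_section_apply => //; near: x; exact: smooth_section_near.
Unshelve. all: by end_near. Qed.

Lemma smooth_section0 q : smooth_section (h := h) E q (fun=> 0).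
Proof.
near=> x; split; first by have [] := subE (h x).
by move=> f _; exact: smooth_at_cst.
Unshelve. all: by end_near. Qed.

Lemma smooth_section_sum (I : Type) (r : seq I) q (a : I -> N -> R)
    (s : I -> field_along h) :
  (forall i, smooth_at q (a i)) -> (forall i, smooth_section E q (s i)) ->
  smooth_section E q (fun x => \sum_(i <- r) a i x *: s i x).
Proof.
move=> sa ss; elim: r => [|i r IH].
  by apply: smooth_section_eq (smooth_section0 q); near=> x; rewrite big_nil.
apply: smooth_section_eq (smooth_section_lin (sa i) (ss i) IH).
by near=> x; rewrite big_cons.
Unshelve. all: by end_near. Qed.

Lemma connection_sum D (I : Type) (r : seq I) q (v : tangent q)
    (a : I -> N -> R) (s : I -> field_along h) : is_connection E D ->
  (forall i, smooth_at q (a i)) -> (forall i, smooth_section E q (s i)) ->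
  D q v (fun x => \sum_(i <- r) a i x *: s i x) =
  \sum_(i <- r) (v (a i) *: s i q + a i q *: D q v (s i)).
Proof.
move=> [Dloc _ Dadd Dleib _] sa ss; elim: r => [|i r IH].
  rewrite big_nil (_ : (fun x => _) = (fun=> 0)); last first.
    by apply: functional_extensionality_dep => x; rewrite big_nil.
  have := Dadd q v _ _ (smooth_section0 q) (smooth_section0 q).
  rewrite (_ : (fun x => 0 + 0) = (fun=> 0)); last first.
    by apply: functional_extensionality_dep => x; rewrite addr0.
  by move=> /eqP; rewrite -subr_eq subrr eq_sym => /eqP.
rewrite big_cons -IH -Dleib // -Dadd.
- by congr (D q v _); apply: functional_extensionality_dep => x; rewrite big_cons.
- have := smooth_section_lin (sa i) (ss i) (smooth_section0 q).
  by apply: smooth_section_eq; near=> x; rewrite addr0.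
- exact: smooth_section_sum.
Unshelve. all: by end_near. Qed.

End Sections.

(** * The orthogonal projection to the complement of a subbundle *)

Section Projection.
Context {R : realType} {n k : nat} {M : manifold R n}.
Variables (F : forall p : M, set (tangent p)).
Variable g : forall p : M, tangent p -> tangent p -> R.
Hypotheses (subF : subbundle k F) (riemg : riemannian g).
Local Notation vfield := (field_along (@idfun M)).
Implicit Types (p : M) (X Y Z : vfield).

Lemma metricC p (u w : tangent p) : g u w = g w u.
Proof. by have [+ _ _ _] := riemg; apply. Qed.

Lemma metric_linl p a (u w z : tangent p) : g (a *: u + w) z = a * g u z + g w z.
Proof. by have [_ + _ _] := riemg; apply. Qed.

Lemma metric0l p (w : tangent p) : g 0 w = 0.
Proof. by have := metric_linl (-1) 0 0 w; rewrite scaler0 addr0 => ->; ring. Qed.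

Lemma metricDl p (u w z : tangent p) : g (u + w) z = g u z + g w z.
Proof. by rewrite -[u]scale1r metric_linl scale1r mul1r. Qed.

Lemma metricZl p a (u z : tangent p) : g (a *: u) z = a * g u z.
Proof. by rewrite -[a *: u]addr0 metric_linl metric0l addr0. Qed.

Lemma metricBl p (u w z : tangent p) : g (u - w) z = g u z - g w z.
Proof. by rewrite metricDl -scaleN1r metricZl mulN1r. Qed.

Lemma metricDr p (u w z : tangent p) : g z (u + w) = g z u + g z w.
Proof. by rewrite metricC metricDl -!(metricC z). Qed.

Lemma metricZr p a (u z : tangent p) : g z (a *: u) = a * g z u.
Proof. by rewrite metricC metricZl metricC. Qed.

Lemma metric_suml p (I : finType) (a : I -> R) (u : I -> tangent p) z :
  g (\sum_i a i *: u i) z = \sum_i a i * g (u i) z.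
Proof.
elim/big_rec2: _ => [|i y1 y2 _ <-]; first exact: metric0l.
by rewrite metric_linl.
Qed.

Lemma metric_eq0 p (w : tangent p) : g w w = 0 -> w = 0.
Proof.
have [_ _ pos _] := riemg; move=> gw; apply/eqP; apply: contraT => /pos.
by rewrite gw ltxx.
Qed.

Lemma metric_smooth p X Y : smooth_section full p X -> smooth_section full p Y ->
  smooth_at p (fun q => g (X q) (Y q)).
Proof. by have [_ _ _ +] := riemg; apply. Qed.

Lemma subbundle_subspace : fiberwise_subspace F.
Proof.
move=> p; have [_ /(_ p)[X [_ /nbhs_singleton[_ _ ->]]]] := subF; split.
  by exists (fun=> 0) => //; rewrite big1 // => i _; rewrite scale0r.
move=> a _ _ [b b0 <-] [c c0 <-]; exists (fun i => a * b i + c i).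
  by move=> i ki /=; rewrite b0 // c0 // mulr0 addr0.
rewrite scaler_sumr -big_split; apply: eq_bigr => i _.
by rewrite scalerDl scalerA.
Qed.

Lemma orthocomp_subspace : fiberwise_subspace (orthocomp g F).
Proof.
move=> p; split=> [w _|a u w ou ow z Fz]; first exact: metric0l.
by rewrite metric_linl ou // ow // mulr0 addr0.
Qed.

Lemma subbundle_frame p : exists X : 'I_n -> tangent p,
  forall u, exists a : 'I_n -> R, u = \sum_i a i *: X i.
Proof.
have [_ /(_ p)[X [_ /nbhs_singleton[_ sp _]]]] := subF.
by exists (X^~ p).
Qed.

(** The extension has constant coefficients in a local frame. *)
Lemma subbundle_extension p (u : tangent p) : exists2 X : vfield,
  smooth_section full p X & X p = u.
Proof.
have [_ /(_ p)[X [sX /nbhs_singleton[_ /(_ u)[a ->] _]]]] := subF.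
exists (fun q => \sum_i a i *: X i q) => //.
by apply: (smooth_section_sum _ _ (a := fun i => cst (a i))) => // i;
  exact: smooth_at_cst.
Qed.

Lemma subbundle_extension_in p (u : tangent p) : F u -> exists2 X : vfield,
  smooth_section F p X & X p = u.
Proof.
have [_ /(_ p)[X [sX Xp]]] := subF.
have [_ _ ->] := nbhs_singleton Xp => -[a a0 <-].
exists (fun q => \sum_i a i *: X i q) => //.
have : smooth_section full p (fun q => \sum_i a i *: X i q).
  by apply: (smooth_section_sum _ _ (a := fun i => cst (a i))) => // i;
    exact: smooth_at_cst.
apply: filterS2 Xp => q [_ _ ->] [_ sf]; split=> //.
by exists a.
Qed.

(** The Gram-Schmidt process, stated for the projection away from the first [l] fields
    of the frame, so that the induction on [l] applies it both to [Z] and to the next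
    field [X_l]: if [T] and [Y0] are the projections of [X_l] and [Z], then
    [Y0 - <Y0,T>/<T,T> T] is the next projection of [Z].  Here [T] does not vanish
    because [X_l] is independent of the preceding fields. *)
Lemma gram_schmidt p (X : 'I_n -> vfield) (l : nat) : (l <= n)%N ->
  (forall i, smooth_section full p (X i)) ->
  (\forall q \near p, forall a : 'I_n -> R,
     \sum_i a i *: X i q = 0 -> forall i, a i = 0) ->
  forall Z, smooth_section full p Z -> exists2 Y : vfield,
    smooth_section full p Y &
    \forall q \near p,
      (exists2 a : 'I_n -> R, forall i : 'I_n, (l <= i)%N -> a i = 0 &
         Z q - Y q = \sum_i a i *: X i q) /\
      (forall i : 'I_n, (i < l)%N -> g (Y q) (X i q) = 0).
Proof.
move=> ln sX freeX; elim: l ln => [_ Z sZ|l IH ln Z sZ].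
  exists Z => //; near=> q; split=> //.
  exists (fun=> 0) => //.
  by rewrite subrr big1 // => i _; rewrite scale0r.
have [Y0 sY0 Y0p] := IH (ltnW ln) Z sZ.
have [T sT Tp] := IH (ltnW ln) _ (sX (Ordinal ln)).
have Tn0 : \forall q \near p, g (T q) (T q) != 0.
  move: freeX Tp; apply: filterS2 => q freeq [[a a0 XT] _].
  apply/eqP => /metric_eq0 T0; move: XT; rewrite T0 subr0 => XE.
  have := freeq (fun i => (i == Ordinal ln)%:R - a i).
  have -> : \sum_i ((i == Ordinal ln)%:R - a i) *: (X i q : tangent q) = 0.
    under eq_bigr do rewrite scalerBl.
    rewrite sumrB -XE (bigD1 (Ordinal ln)) //= eqxx scale1r big1 ?addr0 ?subrr //.
    by move=> i /negbTE ->; rewrite scale0r.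
  move=> /(_ erefl (Ordinal ln)); rewrite eqxx a0 //= subr0 => /eqP.
  by rewrite oner_eq0.
pose c q := - g (Y0 q) (T q) * (g (T q) (T q))^-1.
have sc : smooth_at p c.
  apply: smooth_atM; last by apply: smooth_atV => //; exact: metric_smooth.
  apply: smooth_at_eq (smooth_at_lin (-1) (metric_smooth sY0 sT) (smooth_at_cst p 0)).
  by near=> q => /=; rewrite addr0 mulN1r.
exists (fun q => c q *: T q + Y0 q); first exact: smooth_section_lin.
near=> q.
have tn0 : g (T q) (T q) != 0 by near: q.
have [[a a0 Ta] T0] : (exists2 a : 'I_n -> R, forall i : 'I_n, (l <= i)%N -> a i = 0 &
    X (Ordinal ln) q - T q = \sum_i a i *: X i q) /\
    (forall i : 'I_n, (i < l)%N -> g (T q) (X i q) = 0) by near: q.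
have [[b b0 Yb] Y00] : (exists2 a : 'I_n -> R, forall i : 'I_n, (l <= i)%N -> a i = 0 &
    Z q - Y0 q = \sum_i a i *: X i q) /\
    (forall i : 'I_n, (i < l)%N -> g (Y0 q) (X i q) = 0) by near: q.
have ortho (i : 'I_n) : (i < l)%N -> g (c q *: T q + Y0 q) (X i q) = 0.
  by move=> il; rewrite metric_linl T0 // Y00 // mulr0 addr0.
split; last first.
  move=> i; rewrite ltnS leq_eqVlt => /orP[/eqP il|]; last exact: ortho.
  have -> : i = Ordinal ln by exact: val_inj.
  rewrite -[X (Ordinal ln) q](subrK (T q)) Ta metricDr metricC metric_suml big1.
    by rewrite metric_linl /c mulNr mulNr -mulrA mulVf // add0r mulr1 addNr.
  move=> j _; have [lj|jl] := leqP l j; first by rewrite a0 // mul0r.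
  by rewrite metricC ortho // mulr0.
exists (fun i => b i + c q * (a i - (i == Ordinal ln)%:R)).
  move=> i li; rewrite b0 ?a0 ?(ltnW li) // add0r.
  rewrite (_ : _ == _ = false) ?subrr ?mulr0 //.
  by apply/eqP => iE; move: li; rewrite iE /= ltnn.
under eq_bigr do rewrite scalerDl -scalerA scalerBl.
rewrite big_split /= -Yb -scaler_sumr sumrB -Ta.
rewrite (bigD1 (Ordinal ln)) //= [in RHS]eqxx scale1r [in RHS]big1 ?addr0; last first.
  by move=> i /negbTE ->; rewrite scale0r.
rewrite [in RHS](addrAC _ (- T q)) subrr add0r scalerN opprD addrA.
by rewrite addrAC.
Unshelve. all: by end_near. Qed.

(** Uniqueness holds as [F] meets its orthogonal complement in 0. *)
Lemma pbotE p (u w : tangent p) : orthocomp g F w -> F (u - w) -> pbot g F u = w.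
Proof.
move=> ow Fw; rewrite /pbot; case: xgetP => [w' _ [ow' Fw']|/(_ w)]; last by case.
apply/eqP; rewrite -subr_eq0; apply/eqP/metric_eq0.
have Fd : F (w' - w).
  have -> : w' - w = -1 *: (u - w') + (u - w).
    by rewrite scaleN1r opprB addrA subrK.
  exact: (subbundle_subspace p).2.
by rewrite {1}metricBl ow // ow' // subrr.
Qed.

Lemma ortho_section p Z : smooth_section full p Z -> exists2 Y : vfield,
  smooth_section full p Y &
  \forall q \near p, orthocomp g F (Y q) /\ F (Z q - Y q).
Proof.
have [kn /(_ p)[X [sX Xp]]] := subF; move=> sZ.
have [|Y sY Yp] := gram_schmidt kn sX _ sZ.
  by apply: filterS Xp => q [].
exists Y => //; move: Xp Yp; apply: filterS2 => q [_ _ FE] [[a a0 ZY] Yo].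
split; last by rewrite FE; exists a.
move=> w; rewrite FE => -[b b0 <-]; rewrite metricC metric_suml big1 // => i _.
have [ki|ik] := leqP k i; first by rewrite b0 // mul0r.
by rewrite metricC Yo // mulr0.
Qed.

Lemma pbotP p (u : tangent p) : orthocomp g F (pbot g F u) /\ F (u - pbot g F u).
Proof.
have [X sX <-] := subbundle_extension u.
have [Y _ /nbhs_singleton[oY FY]] := ortho_section sX.
by rewrite (pbotE oY FY).
Qed.

(** The pointwise projection is given by a choice, and its uniqueness identifies it
    with the smooth section built by the Gram-Schmidt process. *)
Lemma pbot_smooth p Z : smooth_section full p Z ->
  smooth_section (orthocomp g F) p (fun q => pbot g F (Z q)).
Proof.
move=> /ortho_section[Y sY Yp].
apply: (smooth_section_eq (s := Y)).
  by apply: filterS Yp => q [oY FY]; rewrite (pbotE oY FY).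
by move: Yp sY; apply: filterS2 => q [oY _] [_ sf].
Qed.

Lemma pbot_id p (u : tangent p) : orthocomp g F u -> pbot g F u = u.
Proof. by move=> ou; apply: pbotE; rewrite // subrr; exact: (subbundle_subspace p).1. Qed.

Lemma pbot_eq0 p (u : tangent p) : F u -> pbot g F u = 0.
Proof. by move=> Fu; apply: pbotE; rewrite ?subr0 //; exact: (orthocomp_subspace p).1. Qed.

Lemma pbot_lin p a (u w : tangent p) :
  pbot g F (a *: u + w) = a *: pbot g F u + pbot g F w.
Proof.
have [ou Fu] := pbotP u; have [ow Fw] := pbotP w; apply: pbotE.
  exact: (orthocomp_subspace p).2.
by rewrite opprD addrACA -scalerBr; exact: (subbundle_subspace p).2.
Qed.

Lemma pbot_sum p (I : finType) (a : I -> R) (u : I -> tangent p) :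
  pbot g F (\sum_i a i *: u i) = \sum_i a i *: pbot g F (u i).
Proof.
elim/big_rec2: _ => [|i y1 y2 _ <-]; last by rewrite pbot_lin.
exact/pbot_eq0/(subbundle_subspace p).1.
Qed.

Lemma metric_pbot p (u w : tangent p) : orthocomp g F w -> g (pbot g F u) w = g u w.
Proof.
move=> ow; have [_ Fu] := pbotP u.
by rewrite -[in RHS](subrK (pbot g F u) u) metricDl [g (u - _) w]metricC ow // add0r.
Qed.

Lemma adiabaticC eps p (u w : tangent p) :
  adiabatic g F eps u w = adiabatic g F eps w u.
Proof. by rewrite /adiabatic metricC [g (pbot _ _ _) _]metricC. Qed.

(** This and the next lemma reduce every product in Koszul's formula to [g] itself. *)
Lemma adiabatic_ortho eps p (u w : tangent p) : orthocomp g F w ->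
  adiabatic g F eps u w = eps^-1 * g u w.
Proof.
by move=> ow; rewrite /adiabatic (pbot_id ow) subrr metricC metric0l add0r metric_pbot.
Qed.

Lemma adiabatic_tangent eps p (u w : tangent p) : F w ->
  adiabatic g F eps u w = g u w.
Proof.
move=> Fw; rewrite /adiabatic (pbot_eq0 Fw) subr0 [g (pbot _ _ _) 0]metricC metric0l mulr0.
by rewrite addr0 metricBl (pbotP u).1 // subr0.
Qed.

End Projection.

(** * Koszul's formula for the adiabatic metric *)

Section Koszul.
Context {R : realType} {n k : nat} {M : manifold R n}.
Variables (F : forall p : M, set (tangent p)).
Variable g : forall p : M, tangent p -> tangent p -> R.
Hypotheses (subF : subbundle k F) (riemg : riemannian g).
Local Notation vfield := (field_along (@idfun M)).
Implicit Types (p : M) (X V W : vfield).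

(** Torsion-freeness and the three derivatives [X<W,V>], [W<X,V>] and [V<X,W>] give
    Koszul's formula.  The last two derivatives vanish since [X] stays orthogonal to
    [V] and [W]; everything is then multiplied by [eps]. *)
Lemma koszul_ortho (eps : R) D p X W V : 0 < eps ->
  levi_civita (adiabatic g F eps) D -> smooth_section F p X ->
  smooth_section (orthocomp g F) p W -> smooth_section (orthocomp g F) p V ->
  2 * g (D p (X p) W) (V p) =
  X p (fun q => g (W q) (V q)) + g (bracket X W p) (V p)
  - g (bracket X V p) (W p) - eps * g (bracket W V p) (X p).
Proof.
move=> eps0 [_ torsion metric] sX sW sV.
have [sX' sW' sV'] := And3 (smooth_section_full sX) (smooth_section_full sW)
  (smooth_section_full sV).
have FX := smooth_section_val sX.
have oW := smooth_section_val sW; have oV := smooth_section_val sV.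
have orthoE (u w : tangent p) : orthocomp g F w -> adiabatic g F eps u w = eps^-1 * g u w.
  exact: (adiabatic_ortho subF riemg).
have orthoE' (u w : tangent p) : orthocomp g F u -> adiabatic g F eps u w = eps^-1 * g u w.
  by move=> ou; rewrite (adiabaticC _ riemg) orthoE // (metricC riemg).
have tangE (u w : tangent p) : F u -> adiabatic g F eps u w = g u w.
  move=> Fu; rewrite (adiabaticC _ riemg) (adiabatic_tangent subF riemg) //.
  exact: metricC.
have zero Y (u : tangent p) : smooth_section (orthocomp g F) p Y ->
    u (fun q => adiabatic g F eps (X q) (Y q)) = 0.
  move=> sY; rewrite -(tangent_cst0 u); apply/esym/tangent_near_eq.
    exact: smooth_at_cst.
  move: sX sY; apply: filterS2 => q [FXq _] [oYq _].
  by rewrite (adiabatic_ortho subF riemg) // (metricC riemg) oYq // mulr0.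
have XWV : X p (fun q => adiabatic g F eps (W q) (V q)) =
    eps^-1 * X p (fun q => g (W q) (V q)).
  rewrite -tangentZ; last exact: metric_smooth.
  apply/esym/tangent_near_eq.
    have sWV := metric_smooth riemg sW' sV'.
    apply: smooth_at_eq (smooth_at_lin eps^-1 sWV (smooth_at_cst p 0)).
    by near=> q; rewrite /= addr0.
  by move: sV; apply: filterS => q [oVq _]; rewrite (adiabatic_ortho subF riemg).
have EX := metric p (X p) _ _ sW' sV'.
have EW := metric p (W p) _ _ sX' sV'.
have EV := metric p (V p) _ _ sX' sW'.
rewrite XWV (orthoE _ _ oV) (orthoE' _ _ oW) in EX.
rewrite zero // orthoE // tangE // in EW.
rewrite zero // orthoE // tangE // in EV.
have tXW := torsion p _ _ sX' sW'.
have tXV := torsion p _ _ sX' sV'.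
have tWV := torsion p _ _ sW' sV'.
rewrite -tXW -tXV -tWV !(metricBl riemg).
rewrite ![g (X p) _](metricC riemg) in EW EV.
rewrite [g (W p) _](metricC riemg) in EX.
have e1 : eps * eps^-1 = 1 by rewrite mulfV // gt_eqF.
have EX' := congr1 ( *%R eps) EX; have EW' := congr1 ( *%R eps) EW.
have EV' := congr1 ( *%R eps) EV.
rewrite mulrDr !mulrA e1 !mul1r in EX'.
rewrite mulr0 mulrDr !mulrA e1 !mul1r in EW'.
rewrite mulr0 mulrDr !mulrA e1 !mul1r in EV'.
(* the products [f] and [i] of D_W X and D_V X are eliminated by E1 and E2 *)
move: EX' EW' EV'.
move: (X p _) (g (D p (X p) W) _) (g (D p (X p) V) _).
move: (g (D p (W p) X) _) (g (D p (V p) X) _).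
move: (g (D p (W p) V) _) (g (D p (V p) W) _).
rewrite /idfun /= => a b f i c d e -> E1 E2.
have -> : f = - (eps * a) by apply/eqP; rewrite -addr_eq0 -E1.
have -> : i = - (eps * b) by apply/eqP; rewrite -addr_eq0 -E2.
ring.
Unshelve. all: by end_near. Qed.

End Koszul.

(** * Integral manifolds *)

Section Leaf.
Context {R : realType} {n k : nat} {M : manifold R n} {L : manifold R k}.
Variable h : L -> M.

Lemma tangent_map_linear q : smooth_map h ->
  linear (@tangent_map R k n L M h q).
Proof.
move=> sh a u w; apply: tangent_ext => f sf.
rewrite [RHS]/(a * tangent_map h u f + tangent_map h w f).
by rewrite !tangent_mapE.
Qed.

Lemma smooth_section_restrict (E : forall p : M, set (tangent p)) q
    (W : field_along (@idfun M)) : smooth_map h -> smooth_section E (h q) W ->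
  smooth_section (h := h) E q (fun x => W (h x)).
Proof.
move=> sh sW; have [ch _] := sh.
have : \forall x \near q, smooth_section E (h x) W.
  exact: (ch q _ (smooth_section_near sW)).
apply: filterS => x sWx; split; first exact: smooth_section_val sWx.
move=> f sf; apply: (smooth_at_comp sh (f := fun y => W y f)).
exact: (smooth_section_apply sWx).
Qed.

Variables (F : forall p : M, set (tangent p)).
Hypotheses (subF : subbundle k F) (intF : integral_manifold F h).

Lemma integral_manifold_smooth : smooth_map h.
Proof. by case: intF. Qed.

Lemma subbundle_frame_in p : exists Y : 'I_k -> tangent p,
  forall u, F u -> exists a : 'I_k -> R, u = \sum_j a j *: Y j.
Proof.
have [kn /(_ p)[X [_ /nbhs_singleton[_ _ FE]]]] := subF.
exists (fun j => X (widen_ord kn j) p) => u; rewrite FE => -[a a0 <-].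
exists (fun j => a (widen_ord kn j)).
rewrite -(big_ord_narrow (F := fun i => a i *: X i p) kn).
rewrite (bigID (fun i : 'I_n => (i < k)%N)) /= [X in _ + X]big1 ?addr0 //.
by move=> i; rewrite -leqNgt => /a0 ->; rewrite scale0r.
Qed.

(** The immersion identifies the tangent space of the leaf with the fibre of [F], of
    dimension [k], so the [k] coordinate fields of a chart of the leaf span it; the
    extension has constant coefficients in them. *)
Lemma leaf_extension q (v : tangent q) : exists2 X : field_along (@idfun L),
  smooth_section full q X & X q = v.
Proof.
have [_ _ _ _ /(_ q)[injh rangeh]] := intF.
have [c ac cq] := atlas_cover q.
have [Y FY] := subbundle_frame_in (h q).
have spanY (u : tangent q) : exists b : 'I_k -> R,
    tangent_map h u = \sum_j b j *: Y j.
  by apply: FY; rewrite -rangeh; exists u.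
have lin_dh := @tangent_map_linear q integral_manifold_smooth.
have vE := coord_field_span ac cq lin_dh injh spanY v.
exists (fun x => \sum_i v (fun y => cmap c y 0 i) *: coord_field c i x) => //.
apply: (smooth_section_sum _ _ (a := fun i => cst (v (fun y => cmap c y 0 i)))) => // i.
  exact: smooth_at_cst.
exact: coord_field_smooth.
Qed.

Variable E : forall p : M, set (tangent p).

(** The axioms of a connection place [D_X s] in [E] for smooth fields [X] only, so the
    vector [v] is extended. *)
Lemma connection_val D q (v : tangent q) (s : field_along h) :
  is_connection E D -> smooth_section E q s -> E (D q v s).
Proof.
have [X sX <-] := leaf_extension v => -[_ _ _ _ Dsm] ss.
exact: (smooth_section_val (Dsm _ _ _ sX ss)).
Qed.

End Leaf.

(** * The difference from the unitary connection *)

Section AdiabaticDifference.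
Context {R : realType} {n k : nat} {M : manifold R n} {L : manifold R k}.
Variables (F : forall p : M, set (tangent p)).
Variable g : forall p : M, tangent p -> tangent p -> R.
Hypotheses (subF : subbundle k F) (riemg : riemannian g).
Variable h : L -> M.
Hypothesis intF : integral_manifold F h.
Let sh := integral_manifold_smooth intF.

(** A vector is the combination of the coordinate fields with its values on the
    coordinate functions as coefficients, and projecting to [F^bot] leaves [U]
    unchanged. *)
Lemma normal_section_generators q (U : field_along h) :
  smooth_section (orthocomp g F) q U ->
  exists (b : 'I_n -> L -> R) (W : 'I_n -> field_along (@idfun M)),
    [/\ forall i, smooth_at q (b i),
        forall i, smooth_section (orthocomp g F) (h q) (W i)
      & \forall x \near q, \sum_i b i x *: W i (h x) = U x].
Proof.
move=> sU; have [c ac ch] := atlas_cover (h q).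
exists (fun i x => U x (fun y => cmap c y 0 i)).
exists (fun i p => pbot g F (coord_field c i p)); split.
- by move=> i; apply: smooth_section_apply sU _; exact: smooth_at_coord.
- by move=> i; apply: (pbot_smooth subF riemg); exact: coord_field_smooth.
have cnear : \forall x \near q, cdom c (h x) by exact: (sh.1 q _ (near_cdom ch)).
move: cnear sU; apply: filterS2 => x cx [oU _].
have [Y spanY] := subbundle_frame subF (h x).
have lin_id : linear (@idfun (tangent (h x))) by [].
rewrite -[RHS](pbot_id subF riemg oU).
rewrite [in RHS](coord_field_span ac cx lin_id (@inj_id _) spanY (U x)).
by rewrite (pbot_sum subF riemg).
Qed.

Variables (nablaL : R -> operator_along h) (nabla : R -> operator_along (@idfun M)).
Hypothesis LCnabla :
  forall eps : R, 0 < eps -> levi_civita (adiabatic g F eps) (nabla eps).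
Hypothesis restr : forall eps : R, 0 < eps ->
  restriction (orthocomp g F) (compression g F (nabla eps)) (nablaL eps).
Variables B B' : operator_along h.
Hypothesis bottB : bott_connection g F B.
Hypothesis dualB : dual_connection g (orthocomp g F) B B'.
Implicit Types (q : L) (U : field_along h) (W V X : field_along (@idfun M)).

Definition adiabatic_difference eps : operator_along h :=
  fun q v U => nablaL eps v U - unitary_connection B B' v U.

Lemma adiabatic_difference_ortho eps q (v : tangent q) U : 0 < eps ->
  smooth_section (orthocomp g F) q U ->
  orthocomp g F (adiabatic_difference eps v U).
Proof.
move=> /restr[cL _] sU.
have o D cD := connection_val (D := D) subF intF v cD sU.
have oL := o _ cL; have oB := o _ bottB.1; have oB' := o _ dualB.1.
have sub := fun a u w => (orthocomp_subspace F riemg (h q)).2 a u w.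
rewrite /adiabatic_difference /unitary_connection /omega addrC -scaleN1r.
apply: (sub) => //; rewrite addrC; apply: (sub) => //.
by rewrite addrC -scaleN1r; exact: sub.
Qed.

(** The right-hand side is linear in [eps] for fixed [X], [W] and [V].  It measures how
    far [F^bot] is from being integrable. *)
Lemma adiabatic_differenceE eps q (v : tangent q) X W V : 0 < eps ->
  smooth_section F (h q) X -> X (h q) = tangent_map h v ->
  smooth_section (orthocomp g F) (h q) W ->
  smooth_section (orthocomp g F) (h q) V ->
  g (adiabatic_difference eps v (fun x => W (h x))) (V (h q)) =
  - eps / 2 * g (bracket W V (h q)) (X (h q)).
Proof.
move=> eps0 sX Xv sW sV.
have oW := smooth_section_val sW; have oV := smooth_section_val sV.
have kos := koszul_ortho subF riemg eps0 (LCnabla eps0) sX sW sV.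
have LE : g (nablaL eps v (fun x => W (h x))) (V (h q)) =
    g (nabla eps (X (h q)) W) (V (h q)).
  rewrite (restr eps0).2 // -Xv /compression (metric_pbot subF riemg) //.
  congr (g _ _); have [[loc _ _ _ _] _ _] := LCnabla eps0.
  symmetry; apply: loc; first exact: smooth_section_full sW.
  by move: sW; apply: filterS => p [oWp _]; rewrite (pbot_id subF riemg).
have BE Y : smooth_section (orthocomp g F) (h q) Y ->
    forall u, orthocomp g F u ->
    g (B v (fun x => Y (h x))) u = g (bracket X Y (h q)) u.
  by move=> sY u ou; rewrite (bottB.2 q v X) // (metric_pbot subF riemg).
have B'E : g (B' v (fun x => W (h x))) (V (h q)) =
    X (h q) (fun p => g (W p) (V p)) - g (bracket X V (h q)) (W (h q)).
  have := dualB.2 q v _ _ (smooth_section_restrict sh sW) (smooth_section_restrict sh sV).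
  rewrite Xv (tangent_mapE sh); last first.
    apply: (metric_smooth riemg); first exact: smooth_section_full sW.
    exact: smooth_section_full sV.
  by move=> ->; rewrite (metricC riemg (W (h q)) (B v _)) BE // addrK.
rewrite /adiabatic_difference /unitary_connection /omega.
rewrite (metricBl riemg) (metricDl riemg) (metricZl riemg) (metricBl riemg).
by rewrite LE BE // B'E; lra.
Qed.

(** Both sides lie in [F^bot] and have the same products with all sections [V] of
    [F^bot]; the section extending their difference shows that it is orthogonal to
    itself. *)
Lemma adiabatic_difference_restrict eps q (v : tangent q) W : 0 < eps ->
  smooth_section (orthocomp g F) (h q) W ->
  adiabatic_difference eps v (fun x => W (h x)) =
  eps *: adiabatic_difference 1 v (fun x => W (h x)).
Proof.
move=> eps0 sW; have sWh := smooth_section_restrict sh sW.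
have [X sX Xv] : exists2 X : field_along (@idfun M),
    smooth_section F (h q) X & X (h q) = tangent_map h v.
  apply: (subbundle_extension_in subF).
  by have [_ _ _ _ /(_ q)[_ <-]] := intF; exists v.
apply/eqP; rewrite -subr_eq0; apply/eqP/(metric_eq0 riemg).
set d := _ - _.
have od : orthocomp g F d.
  rewrite /d addrC -scaleNr; apply: (orthocomp_subspace F riemg (h q)).2;
    exact: adiabatic_difference_ortho.
have [Y sY Yd] := subbundle_extension subF d.
have sV := pbot_smooth subF riemg sY.
have Vd : pbot g F (Y (h q)) = d by rewrite Yd (pbot_id subF riemg).
rewrite -{2}Vd /d (metricBl riemg) (metricZl riemg).
have E e e0 := adiabatic_differenceE (eps := e) e0 sX Xv sW sV.
rewrite (E _ eps0) (E _ ltr01); lra.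
Qed.

(** The Leibniz terms cancel, so both sides are linear over smooth functions and it is
    enough to compare them on the generators of [normal_section_generators]. *)
Lemma adiabatic_difference_scale eps q (v : tangent q) U : 0 < eps ->
  smooth_section (orthocomp g F) q U ->
  adiabatic_difference eps v U = eps *: adiabatic_difference 1 v U.
Proof.
move=> eps0 sU; have [b [W [sb sW UE]]] := normal_section_generators sU.
have sWh i := smooth_section_restrict sh (sW i).
have ssum := smooth_section_sum (orthocomp_subspace F riemg) (index_enum _) sb sWh.
have tensorial e : 0 < e -> adiabatic_difference e v U =
    \sum_i b i q *: adiabatic_difference e v (fun x => W i (h x)).
  move=> e0.
  have DE D : is_connection (orthocomp g F) D -> D q v U =
      \sum_i (v (b i) *: W i (h q) + b i q *: D q v (fun x => W i (h x))).
    move=> cD; rewrite -(connection_sum (orthocomp_subspace F riemg) _ v cD sb sWh).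
    by have [loc _ _ _ _] := cD; symmetry; exact: loc.
  rewrite /adiabatic_difference /unitary_connection /omega.
  rewrite (DE _ (restr e0).1) (DE _ bottB.1) (DE _ dualB.1).
  rewrite -sumrB scaler_sumr -big_split -sumrB; apply: eq_bigr => i _ /=.
  exact: unitary_leibniz.
rewrite (tensorial _ eps0) (tensorial _ ltr01) scaler_sumr.
apply: eq_bigr => i _; rewrite adiabatic_difference_restrict //.
by rewrite !scalerA mulrC.
Qed.

End AdiabaticDifference.

Theorem theorem1p1 (R : realType) (n k : nat) (M : manifold R n)
  (compactM : compact [set: M])
  (F : forall p : M, set (tangent p))
  (subF : subbundle k F) (intF : integrable_bundle F)
  (g : forall p : M, tangent p -> tangent p -> R) (riemg : riemannian g)
  (nabla : R -> operator_along (@idfun M))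
  (LCnabla : forall eps, 0 < eps -> levi_civita (adiabatic g F eps) (nabla eps))
  (L : manifold R k) (h : L -> M) (leafL : leaf F h)
  (nablaL : R -> operator_along h)
  (restr : forall eps, 0 < eps ->
     restriction (orthocomp g F) (compression g F (nabla eps)) (nablaL eps))
  (B : operator_along h) (bottB : bott_connection g F B)
  (B' : operator_along h) (dualB : dual_connection g (orthocomp g F) B B')
  (q : L) (v : tangent q) (U : field_along h)
  (sU : smooth_section (orthocomp g F) q U) :
  (fun eps : R =>
     let d := nablaL eps q v U - unitary_connection B B' v U in
     Num.sqrt (g (h q) d d)) @ 0^'+ --> (0 : R).
Proof.
set d1 := adiabatic_difference nablaL B B' 1 v U.
have E : \forall eps \near 0^'+,
    eps * Num.sqrt (g (h q) d1 d1) =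
    let d := nablaL eps q v U - unitary_connection B B' v U in
    Num.sqrt (g (h q) d d).
  near=> eps; have eps0 : 0 < eps by [].
  have := adiabatic_difference_scale subF riemg leafL.1 LCnabla restr bottB dualB v eps0 sU.
  rewrite {1}/adiabatic_difference /= => ->.
  rewrite (metricZl riemg) (metricZr riemg) mulrA -expr2 sqrtrM ?sqr_ge0 //.
  by rewrite sqrtr_sqr gtr0_norm.
have lim0 : (fun eps => eps * Num.sqrt (g (h q) d1 d1)) @ 0^'+ -->
    0 * Num.sqrt (g (h q) d1 d1).
  by apply: cvgM; [apply: cvg_at_right_filter; exact: cvg_id|exact: cvg_cst].
by rewrite mul0r in lim0; apply: cvg_trans lim0; exact: near_eq_cvg.
Unshelve. all: by end_near. Qed.
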